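(* Let $n\in\mathbb{N}$, $n\ge 1$, let $C_0,C_1\in\mathbb{R}^n$, $r_0,r_1>0$, and let $\mathcal{L}=\mathcal{U}\cap\bar{\mathcal{B}}(C_0,r_0)\cap\bar{\mathcal{B}}(C_1,r_1)$, with $$\min_{x\in\mathcal{U}}\|x-C_i\|\ge 1\qquad\text{for all } i\in\{0,1\}.$$ For $i\in\{0,1\}$ define $$\mathcal{K}_i=\mathrm{conv}(C_i,\mathcal{U}):=\{\lambda x+(1-\lambda)y : \lambda\in[0,1],\ x,y\in\mathcal{U}\cup\{C_i\}\}.$$ Then for every $K>0$, $$|\mathrm{vol}(\mathcal{L})-T(K)|\le\frac{n}{\sqrt{2n-1}\cdot K}\cdot\sum_{i=0}^{1}\mathrm{vol}(\mathcal{K}_i).$$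
   Context: $\mathcal{U}=\{x\in\mathbb{R}^n : 0\le x_i\le 1,\ i=1,\dots,n\}$ is the unit hypercube, $\|\cdot\|$ is the Euclidean norm, $\bar{\mathcal{B}}(C,r)$ is the closed ball of center $C$ and radius $r$, and $\mathrm{vol}$ is $n$-dimensional Lebesgue measure. For $K>0$ and $t\in\mathbb{R}$ put $$H_K(t)=\frac12+\frac{1}{\sqrt{\pi}}\int_0^K t\,e^{-(ty)^2}\,dy .$$ For $i\in\{0,1\}$ let $\rho_i(x)=r_i^2-\|x-C_i\|^2$, and define $$T(K)=\int_{0}^{1}dx_1\cdots\int_0^1 dx_n\; H_K(\rho_0(x))\,H_K(\rho_1(x)).$$ *)

(* Defs.v *)
From HB Require Import structures.
From mathcomp Require Import all_boot all_order all_algebra.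
From mathcomp Require Import all_classical all_reals all_analysis.

Set Implicit Arguments.
Unset Strict Implicit.
Unset Printing Implicit Defensive.
Import Order.TTheory GRing.Theory Num.Theory.
Import numFieldNormedType.Exports.
Local Open Scope classical_set_scope.
Local Open Scope ring_scope.

(* The library has Lebesgue measure on R only; Lebesgue measure on R^n is built
   here as the n-fold product of that measure, on the Borel sigma-algebra of
   n.-tuple R (generated by the coordinate maps).  [lebesgue_tuple_prod] gives
   its values on products of measurable sets, which characterize it. *)
Section lebesgue_measure_Rn.
Context {R : realType}.

Definition tuple_cons n (p : measurableTypeR R * n.-tuple (measurableTypeR R)) :
  n.+1.-tuple (measurableTypeR R) := [tuple of p.1 :: p.2].

Lemma measurable_tuple_cons n : measurable_fun [set: _] (@tuple_cons n).
Proof. exact: measurable_cons. Qed.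

Section step.
Variables (n : nat)
  (mu : {sigma_finite_measure set (n.-tuple (measurableTypeR R)) -> \bar R}).

Definition lebesgue_tupleS :=
  pushforward (@lebesgue_measure R \x mu)%E (@tuple_cons n).

Let m0 : lebesgue_tupleS set0 = 0%E.
Proof. by rewrite /lebesgue_tupleS /pushforward preimage_set0 measure0. Qed.

Let m_ge0 A : (0 <= lebesgue_tupleS A)%E.
Proof. by rewrite /lebesgue_tupleS /pushforward measure_ge0. Qed.

Let m_sigma_additive : semi_sigma_additive lebesgue_tupleS.
Proof.
move=> F mF tF mUF; rewrite /lebesgue_tupleS /pushforward preimage_bigcup.
have mcons B : measurable B -> measurable (@tuple_cons n @^-1` B).
  by move=> mB; rewrite -[X in measurable X]setTI; exact: measurable_tuple_cons.
apply: measure_semi_sigma_additive.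
- by move=> k; exact: mcons.
- apply/trivIsetP => /= i j _ _ ij; rewrite -preimage_setI.
  by move/trivIsetP : tF => /(_ _ _ _ _ ij) ->//; rewrite preimage_set0.
- by rewrite -preimage_bigcup; exact: mcons.
Qed.

HB.instance Definition _ := isMeasure.Build _ _ _ lebesgue_tupleS
  m0 m_ge0 m_sigma_additive.

Let m_sigma_finite : sigma_finite setT lebesgue_tupleS.
Proof.
have /sigma_finiteP[F [TF ndF Foo]] := sigma_finiteT (@lebesgue_measure R).
have /sigma_finiteP[G [TG ndG Goo]] := sigma_finiteT mu.
pose u (t : n.+1.-tuple (measurableTypeR R)) := (thead t, [tuple of behead t]).
have mu_ : measurable_fun [set: _] u.
  apply/measurable_fun_pair; last exact: measurable_behead.
  exact: measurable_tnth.
exists (fun k => u @^-1` (F k `*` G k)).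
  rewrite -preimage_bigcup; apply/esym; rewrite -subTset => t _ /=.
  have : setT (u t).1 by []. rewrite TF => -[i _ Fi].
  have : setT (u t).2 by []. rewrite TG => -[j _ Gj].
  exists (maxn i j) => //; split.
  - by move: Fi; exact/subsetPset/ndF/leq_maxl.
  - by move: Gj; exact/subsetPset/ndG/leq_maxr.
move=> k; have [mF Fk] := Foo k; have [mG Gk] := Goo k; split.
  by rewrite -[X in measurable X]setTI; apply: mu_ => //; exact: measurableX.
rewrite /lebesgue_tupleS /pushforward -comp_preimage (_ : u \o _ = id).
  by rewrite preimage_id product_measure1E// lte_mul_pinfty// ge0_fin_numE.
apply/funext => -[x t] /=; rewrite /u /tuple_cons theadE /=.
by congr pair; exact/val_inj.
Qed.

HB.instance Definition _ := Measure_isSigmaFinite.Build _ _ _ lebesgue_tupleS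
  m_sigma_finite.

End step.

Fixpoint lebesgue_tuple n :
    {sigma_finite_measure set (n.-tuple (measurableTypeR R)) -> \bar R} :=
  match n with
  | 0 => \d_([tuple] : 0.-tuple (measurableTypeR R))
  | n'.+1 => lebesgue_tupleS (lebesgue_tuple n')
  end.

Lemma lebesgue_tuple_prod n (A : 'I_n -> set (measurableTypeR R)) :
  (forall i, measurable (A i)) ->
  lebesgue_tuple n [set t | forall i, A i (tnth t i)] =
  (\prod_(i < n) lebesgue_measure (A i))%E.
Proof.
elim: n A => [A _|n IH A mA].
  by rewrite big_ord0 /= diracE mem_set// => -[].
pose B : set (n.-tuple (measurableTypeR R)) :=
  [set t | forall i, A (lift ord0 i) (tnth t i)].
have mB : measurable B.
  rewrite (_ : B = \bigcap_(i in [set: 'I_n])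
    ((@tnth n (measurableTypeR R))^~ i @^-1` A (lift ord0 i))).
    apply: fin_bigcap_measurable => // i _; rewrite -[X in measurable X]setTI.
    by apply: measurable_tnth => //; exact: mA.
  by apply/seteqP; split=> t Bt i //=; exact: Bt.
rewrite big_ord_recl -IH// -product_measure1E//=.
rewrite /lebesgue_tupleS /pushforward; congr (_ _).
apply/seteqP; split=> -[x t] /=.
  move=> Axt; split; first by have := Axt ord0; rewrite tnth0.
  by move=> i; have := Axt (lift ord0 i); rewrite tnthS.
move=> [Ax Bt] i; case: (unliftP ord0 i) => [j ->|->]; last by rewrite tnth0.
by rewrite tnthS; exact: Bt.
Qed.

End lebesgue_measure_Rn.

Section cube_and_balls.
Context {R : realType}.

Definition row_of_tuple n (t : n.-tuple R) : 'rV[R]_n := \row_i tnth t i.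

Definition vol n (A : set 'rV[R]_n) : \bar R :=
  lebesgue_tuple n [set t | A (row_of_tuple t)].

(* The library norm on 'rV[R]_n is the max norm, hence also its closed balls. *)
Definition enorm n (x : 'rV[R]_n) : R := Num.sqrt (\sum_i x 0 i ^+ 2).

Definition closed_eball n (C : 'rV[R]_n) (r : R) : set 'rV[R]_n :=
  [set x | enorm (x - C) <= r].

Definition unit_cube n : set 'rV[R]_n :=
  [set x | forall i, 0 <= x 0 i <= 1].
Arguments unit_cube n : clear implicits.

Definition conv_cube n (C : 'rV[R]_n) : set 'rV[R]_n :=
  [set z | exists (l : R) (x y : 'rV[R]_n),
     [/\ 0 <= l <= 1, (unit_cube n `|` [set C]) x, (unit_cube n `|` [set C]) y
       & z = l *: x + (1 - l) *: y]].

Definition smooth_step (K t : R) : R :=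
  2^-1 + (Num.sqrt pi)^-1 *
    \int[lebesgue_measure]_(y in `[0, K]) (t * expR (- (t * y) ^+ 2)).

Definition rho n (C : 'rV[R]_n) (r : R) (x : 'rV[R]_n) : R :=
  r ^+ 2 - enorm (x - C) ^+ 2.

(* The first coordinate is the variable of the outermost integral. *)
Fixpoint iterated_int01 n : (n.-tuple R -> R) -> R :=
  match n with
  | 0 => fun f => f [tuple]
  | n'.+1 => fun f => \int[lebesgue_measure]_(x in `[0, 1])
      iterated_int01 (fun t : n'.-tuple R => f [tuple of x :: t])
  end.

Definition smooth_vol n (C0 : 'rV[R]_n) (r0 : R) (C1 : 'rV[R]_n) (r1 : R)
    (K : R) : R :=
  iterated_int01 (fun t : n.-tuple R =>
    smooth_step K (rho C0 r0 (row_of_tuple t)) *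
    smooth_step K (rho C1 r1 (row_of_tuple t))).

End cube_and_balls.
Arguments unit_cube {R} n _.

(* Main.v *)
Require Import Defs.
From mathcomp Require Import all_boot all_order all_algebra.
From mathcomp Require Import all_classical all_reals all_analysis.
From mathcomp Require Import measurable_realfun ring lra.
Import Order.TTheory GRing.Theory Num.Theory.
Import numFieldNormedType.Exports.
Local Open Scope classical_set_scope.
Local Open Scope ring_scope.

(** The smoothed step [smooth_step K] differs from the step function by at most
    half of the Gaussian [exp (- (K t)^2)] ([smooth_step_error]), so the integrand
    defining the smoothed volume differs from the indicator of the lens, pointwise
    on the cube, by at most the sum over the two balls of
    [exp (- (K (rho x))^2) / 2].  It remains to bound the integral of each of these
    two errors over the cube.

    Such an integral is at most [M sqrt pi / (2 K)], where [M] bounds the density of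
    the random variable [rho x] for [x] uniform in the cube.  Now [rho x] is a
    constant minus the sum of the independent variables [(x_i - C_i)^2], hence its
    density is at most that of any one of them ([le_cube_integral_fiber]).  Because
    the center [C] lies at distance at least 1 from the cube, some coordinate [C_j]
    is at distance [d >= 1 / sqrt n] from the unit interval
    ([ex_far_coordinate]); there [(x_j - C_j)^2] has derivative at least [2 d] in
    absolute value, hence density at most [1 / (2 d) <= sqrt n / 2]
    ([gauss_sqdist_le]).  Each error is thus at most
    [sqrt (pi n) / (4 K) <= n / (sqrt (2 n - 1) K)] ([gauss_constant_le]).  Finally
    the convex hull of the center and the cube contains the cube, so its volume is
    at least 1 ([vol_conv_cube_ge1]), which gives the factors on the right. *)

(** * Monotonicity of the measure on arbitrary sets *)

Section monotone_measure.
Context {R : realType}.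
Implicit Types n : nat.

Section mono.
Import HBNNSimple.
(** For nonnegative functions the integral is a supremum over the simple
    functions below, which is monotone whether or not the integrands are
    measurable. *)
Lemma ge0_le_integral_total d (T : measurableType d)
    (mu : {measure set T -> \bar R}) (f g : T -> \bar R) :
  (forall x, 0 <= f x)%E -> (forall x, f x <= g x)%E ->
  (\int[mu]_x f x <= \int[mu]_x g x)%E.
Proof.
move=> f0 fg; have g0 x : (0 <= g x)%E by exact: le_trans (fg x).
rewrite !ge0_integralTE//; apply: ereal_sup_le => _ [h hf <-].
by exists h => // x; exact: le_trans (hf x) (fg x).
Qed.

End mono.

(** The measure is built from integrals of sections, so it is a total monotone
    set function.  This gives lower bounds on the volume of a convex hull
    directly from an inclusion, without establishing that the hull is a Borel
    set. *)
Lemma le_lebesgue_tuple n (A B : set (n.-tuple (measurableTypeR R))) :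
  A `<=` B -> (lebesgue_tuple n A <= lebesgue_tuple n B)%E.
Proof.
elim: n A B => [|n IH] A B AB /=.
  rewrite !diracE lee_fin ler_nat.
  by case: (boolP (_ \in A)) => //=; rewrite inE => /AB/mem_set ->.
rewrite /lebesgue_tupleS /pushforward /product_measure1.
apply: ge0_le_integral_total => x //=.
apply: IH => t; rewrite /xsection /= !inE; exact: AB.
Qed.

End monotone_measure.

(** * Tonelli's theorem on the unit cube *)

Section cube_tonelli.
Context {R : realType}.
Implicit Types n : nat.

Definition tuple_cube n : set (n.-tuple (measurableTypeR R)) :=
  [set t | forall i, tnth t i \in `[0, 1]].

Lemma measurable_tuple_cube n : measurable (tuple_cube n).
Proof.
rewrite (_ : tuple_cube n = \bigcap_(i in [set: 'I_n])
    ((@tnth n (measurableTypeR R))^~ i @^-1` `[0, 1])).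
  apply: fin_bigcap_measurable => // i _; rewrite -[X in measurable X]setTI.
  by apply: measurable_tnth => //; exact: measurable_itv.
by apply/seteqP; split=> t Bt i //=; exact: Bt.
Qed.

Lemma tuple_cube_cons n :
  @tuple_cons R n @^-1` tuple_cube n.+1 = `[0, 1] `*` tuple_cube n.
Proof.
apply/seteqP; split=> -[x t] /=.
  move=> xt; split=> [|i]; first by have := xt ord0; rewrite tnth0.
  by have := xt (lift ord0 i); rewrite tnthS.
move=> [x01 tc] i; case: (unliftP ord0 i) => [j ->|->]; last by rewrite tnth0.
by rewrite tnthS; exact: tc.
Qed.

Section tonelli.
Variables (n : nat) (f : n.+1.-tuple (measurableTypeR R) -> \bar R).
Hypothesis mf : measurable_fun setT f.
Hypothesis f0 : forall t, (0 <= f t)%E.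

Let g : measurableTypeR R * n.-tuple (measurableTypeR R) -> \bar R :=
  (f \o @tuple_cons R n) \_ (`[0, 1] `*` tuple_cube n).

Let mg : measurable_fun setT g.
Proof.
apply: (measurable_restrictT _ _).1 => /=.
  by apply: measurableX => //; exact: measurable_tuple_cube.
apply: measurable_funTS; apply: measurableT_comp => //.
  exact: measurable_tuple_cons.
Qed.

Let g0 p : (0 <= g p)%E.
Proof. by apply: erestrict_ge0 => //= x; exact: f0. Qed.

Let int_cube_g : (\int[lebesgue_tuple n.+1]_(t in tuple_cube n.+1) f t =
  \int[@lebesgue_measure R \x lebesgue_tuple n]_p g p)%E.
Proof.
rewrite /= /lebesgue_tupleS ge0_integral_pushforward//; last 3 first.
  exact: measurable_tuple_cons.
  exact: measurable_tuple_cube.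
  exact: measurable_funTS.
by rewrite tuple_cube_cons [LHS]integral_mkcond.
Qed.

(** Tonelli's theorem for the decomposition of a tuple into head and tail, in
    both orders of integration. *)
Lemma tonelli_cons :
  (\int[lebesgue_tuple n.+1]_(t in tuple_cube n.+1) f t =
   \int[@lebesgue_measure R]_(x in `[0%R, 1%R])
     \int[lebesgue_tuple n]_(t in tuple_cube n) f (tuple_cons (x, t)))%E.
Proof.
rewrite int_cube_g fubini_tonelli1// [RHS]integral_mkcond.
apply: eq_integral => x _; rewrite /fubini_F /g /patch.
case: ifPn => x01.
  rewrite [RHS]integral_mkcond; apply: eq_integral => t _.
  by rewrite /patch in_setX /= x01.
by rewrite integral0_eq// => t _; rewrite in_setX /= (negbTE x01).
Qed.

Lemma tonelli_cons_swap :
  (\int[lebesgue_tuple n.+1]_(t in tuple_cube n.+1) f t =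
   \int[lebesgue_tuple n]_(t in tuple_cube n)
     \int[@lebesgue_measure R]_(x in `[0%R, 1%R]) f (tuple_cons (x, t)))%E.
Proof.
rewrite int_cube_g fubini_tonelli2// [RHS]integral_mkcond.
apply: eq_integral => t _; rewrite /fubini_G /g /patch.
case: ifPn => t01.
  rewrite [RHS]integral_mkcond; apply: eq_integral => x _.
  by rewrite /patch in_setX /= t01 andbT.
by rewrite integral0_eq// => x _; rewrite in_setX /= (negbTE t01) andbF.
Qed.

(** Measurability of the two inner integrals, needed to bound the outer ones. *)
Lemma measurable_cube_integral_cons :
  measurable_fun setT (fun x : measurableTypeR R =>
    \int[lebesgue_tuple n]_(t in tuple_cube n) f (tuple_cons (x, t)))%E.
Proof.
have mfc : measurable_fun setT (f \o @tuple_cons R n).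
  by apply: measurableT_comp => //; exact: measurable_tuple_cons.
pose h := (f \o @tuple_cons R n) \_ ([set: R] `*` tuple_cube n).
have mh : measurable_fun setT h.
  apply: (measurable_restrictT _ _).1 => /=; last exact: measurable_funTS.
  by apply: measurableX => //; exact: measurable_tuple_cube.
have h0 p : (0 <= h p)%E by apply: erestrict_ge0 => //= x _; exact: f0.
have := measurable_fun_fubini_tonelli_F (m2 := lebesgue_tuple n) h mh h0.
apply: eq_measurable_fun => x _; rewrite /fubini_F [RHS]integral_mkcond.
by apply: eq_integral => t _; rewrite /h /patch in_setX in_setT.
Qed.

Lemma measurable_unit_itv_integral_cons :
  measurable_fun setT (fun t : n.-tuple (measurableTypeR R) =>
    \int[@lebesgue_measure R]_(x in `[0%R, 1%R]) f (tuple_cons (x, t)))%E.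
Proof.
have mfc : measurable_fun setT (f \o @tuple_cons R n).
  by apply: measurableT_comp => //; exact: measurable_tuple_cons.
pose h := (f \o @tuple_cons R n) \_ (`[0%R, 1%R] `*` [set: n.-tuple R]).
have mh : measurable_fun setT h.
  apply: (measurable_restrictT _ _).1 => /=; last exact: measurable_funTS.
  exact: measurableX.
have h0 p : (0 <= h p)%E by apply: erestrict_ge0 => //= x _; exact: f0.
have := measurable_fun_fubini_tonelli_G (m1 := @lebesgue_measure R) h mh h0.
apply: eq_measurable_fun => t _; rewrite /fubini_G [RHS]integral_mkcond.
by apply: eq_integral => x _; rewrite /h /patch in_setX in_setT andbT.
Qed.

End tonelli.

End cube_tonelli.

(** * Integration over the unit cube *)

Section cube_integral.
Context {R : realType}.
Implicit Types n : nat.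

Lemma lebesgue_tuple_cube n : lebesgue_tuple n (@tuple_cube R n) = 1%E.
Proof.
rewrite (_ : tuple_cube n =
  [set t | forall i : 'I_n, [set` `[0%R, 1%R]] (tnth t i)])//.
rewrite (@lebesgue_tuple_prod R n (fun=> [set` `[0%R, 1%R]]))//.
by rewrite big1// => i _; rewrite lebesgue_measure_itv/= lte_fin ltr01 oppr0 adde0.
Qed.

Lemma le_cube_integral_cst n (f : n.-tuple (measurableTypeR R) -> \bar R) (B : R) :
  measurable_fun setT f -> (forall t, 0 <= f t)%E -> (forall t, f t <= B%:E)%E ->
  (\int[lebesgue_tuple n]_(t in tuple_cube n) f t <= B%:E)%E.
Proof.
move=> mf f0 fB.
have -> : B%:E = (\int[lebesgue_tuple n]_(t in @tuple_cube R n) B%:E)%E.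
  rewrite integral_cst; last exact: measurable_tuple_cube.
  by rewrite -[LHS]mule1; congr (_ * _)%E; exact/esym/lebesgue_tuple_cube.
apply: ge0_le_integral => //; first exact: measurable_tuple_cube.
exact: measurable_funTS.
Qed.

Lemma le_unit_itv_integral_cst (f : R -> \bar R) (B : R) :
  measurable_fun setT f -> (forall t, 0 <= f t)%E -> (forall t, f t <= B%:E)%E ->
  (\int[lebesgue_measure]_(t in `[0%R, 1%R]) f t <= B%:E)%E.
Proof.
move=> mf f0 fB.
have -> : B%:E = (\int[@lebesgue_measure R]_(t in `[0%R, 1%R]) B%:E)%E.
  rewrite integral_cst//= lebesgue_measure_itv/= lte_fin ltr01 oppr0 adde0.
  by rewrite mule1.
apply: ge0_le_integral => //.
exact: measurable_funTS.
Qed.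

(** A sum of independent variables has a density bounded by that of any one of
    its terms: if the integral of [phi (A - f j x)] in the single variable [x]
    is at most [B] for every shift [A], then freezing all the other coordinates
    merely changes the shift, and the outer integrals run over a set of
    measure 1. *)
Lemma le_cube_integral_fiber n (phi : R -> R) (f : 'I_n -> R -> R) (B : R)
    (j : 'I_n) :
  measurable_fun setT phi -> (forall i, measurable_fun setT (f i)) ->
  (forall x, 0 <= phi x) ->
  (forall A, (\int[lebesgue_measure]_(x in `[0%R, 1%R])
     (phi (A - f j x))%:E <= B%:E)%E) ->
  forall A, (\int[lebesgue_tuple n]_(t in tuple_cube n)
     (phi (A - \sum_i f i (tnth t i)))%:E <= B%:E)%E.
Proof.
move=> mphi + phi0; elim: n f j => [? []//|n IH] f j mf hB A.
have mF : measurable_fun setT (fun t : n.+1.-tuple (measurableTypeR R) =>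
    (phi (A - \sum_i f i (tnth t i)))%:E).
  apply/measurable_EFinP; apply: measurableT_comp => //.
  apply: measurable_funB => //; apply: measurable_sum => i.
  exact: (measurableT_comp (mf i) (measurable_tnth i)).
have F0 (t : n.+1.-tuple (measurableTypeR R)) :
    (0 <= (phi (A - \sum_i f i (tnth t i)))%:E)%E by rewrite lee_fin.
case: (unliftP ord0 j) => [k|] jE; subst j.
- rewrite tonelli_cons//; apply: (@le_unit_itv_integral_cst (fun x =>
    \int[lebesgue_tuple n]_(t in tuple_cube n)
      (phi (A - \sum_i f i (tnth (tuple_cons (x, t)) i)))%:E)%E) => [||x].
  + exact: (measurable_cube_integral_cons _ _ mF F0).
  + by move=> x; exact: integral_ge0.
  + apply: le_trans (IH (fun i => f (lift ord0 i)) k _ _ (A - f ord0 x)) => //.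
    rewrite le_eqVlt; apply/orP; left; apply/eqP; apply: eq_integral => t _.
    rewrite big_ord_recl tnth0 /= opprD addrA.
    by under eq_bigr do rewrite tnthS.
- rewrite tonelli_cons_swap//; apply: (@le_cube_integral_cst n (fun t =>
    \int[lebesgue_measure]_(x in `[0%R, 1%R])
      (phi (A - \sum_i f i (tnth (tuple_cons (x, t)) i)))%:E)%E) => [||t].
  + exact: (measurable_unit_itv_integral_cons _ _ mF F0).
  + by move=> x; exact: integral_ge0.
  + apply: le_trans (hB (A - \sum_(i < n) f (lift ord0 i) (tnth t i))).
    rewrite le_eqVlt; apply/orP; left; apply/eqP; apply: eq_integral => x _.
    rewrite big_ord_recl tnth0 /= opprD addrCA addrC.
    by under eq_bigr do rewrite tnthS.
Qed.

(** The bound on [F] keeps every intermediate integral finite, so taking the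
    real value of the extended integral at each stage loses nothing. *)
Lemma iterated_int01E n (F : n.-tuple (measurableTypeR R) -> R) :
  measurable_fun setT F -> (forall t, 0 <= F t <= 1) ->
  ((iterated_int01 F)%:E = \int[lebesgue_tuple n]_(t in tuple_cube n) (F t)%:E)%E.
Proof.
elim: n F => [|n IH] F mF F01.
  rewrite /= integral_dirac//; last 2 first.
    exact: measurable_tuple_cube.
    by apply: measurable_funTS; exact/measurable_EFinP.
  by rewrite diracE mem_set ?mul1e// => -[].
have F0 t : (0 <= (F t)%:E)%E by rewrite lee_fin; case/andP: (F01 t).
have F1 t : ((F t)%:E <= 1)%E by rewrite lee_fin; case/andP: (F01 t).
have mEF : measurable_fun setT (fun t => (F t)%:E) by exact/measurable_EFinP.
have mFx (x : R) : measurable_fun setT (fun t => F (@tuple_cons R n (x, t))).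
  apply: measurableT_comp => //.
  apply: (measurableT_comp (@measurable_tuple_cons R n)).
  exact: pair1_measurable.
rewrite [LHS](_ : _ = (fine (\int[lebesgue_tuple n.+1]_(t in tuple_cube n.+1)
    (F t)%:E)%E)%:E).
  rewrite fineK// ge0_fin_numE ?integral_ge0//.
  apply: (@le_lt_trans _ _ 1%E); last exact: ltry.
  exact: le_cube_integral_cst.
rewrite tonelli_cons//; congr (fine _)%:E; apply: eq_integral => x _.
exact: (IH (fun t => F (tuple_cons (x, t)))).
Qed.

End cube_integral.

(** * The Gaussian tail and the smoothed Heaviside function *)

Section gauss_tail.
Context {R : realType}.
Local Notation mu := (@lebesgue_measure R).

Lemma lebesgue_measure_reflect (c : R) (A : set R) : measurable A ->
  pushforward mu (fun x : measurableTypeR R => c - x : measurableTypeR R) A =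
  mu A.
Proof.
have mr : measurable_fun setT
    (fun x : measurableTypeR R => c - x : measurableTypeR R).
  exact: measurable_funB.
move=> mA; apply/esym; apply: lebesgue_measure_unique => //= _ [[a b]] _ <-.
rewrite /pushforward (_ : _ @^-1` _ = [set` `[c - b, c - a[]); last first.
  by apply/seteqP; split => x /=; rewrite !in_itv/=; lra.
rewrite !lebesgue_measure_itv/= !lte_fin.
rewrite (_ : (c - b < c - a) = (a < b)); last lra.
by case: ifP => // _; rewrite -!EFinB; congr _%:E; lra.
Qed.

Lemma ge0_integral_reflect (c : R) (D : set R) (f : R -> \bar R) :
  measurable D -> measurable_fun setT f -> (forall x, 0 <= f x)%E ->
  (\int[mu]_(x in D) f x =
   \int[mu]_(x in (fun x : R => (c - x)%R) @^-1` D) f (c - x)%R)%E.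
Proof.
move=> mD mf f0.
have mr : measurable_fun setT
    (fun x : measurableTypeR R => c - x : measurableTypeR R).
  exact: measurable_funB.
rewrite -(ge0_integral_pushforward mr mu (f := f))//; last exact: measurable_funTS.
apply: eq_measure_integral => //= A mA _.
exact/esym/lebesgue_measure_reflect.
Qed.

(** The density is invariant under the reflection of the line about [m]. *)
Lemma integral_normal_pdf_half (m s : R) : s != 0 ->
  (\int[mu]_(x in `[m, +oo[) (normal_pdf m s x)%:E = (2^-1)%:E)%E.
Proof.
move=> s0.
set I := (X in X = _).
have mpdf (D : set (measurableTypeR R)) :
    measurable_fun D (fun x : measurableTypeR R => (normal_pdf m s x)%:E).
  by apply: measurable_funTS; apply/measurable_EFinP; exact: measurable_normal_pdf.
have pdf0 (x : R) : (0 <= (normal_pdf m s x)%:E)%E.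
  by rewrite lee_fin normal_pdf_ge0.
have symI : (\int[mu]_(x in `]-oo, m]) (normal_pdf m s x)%:E = I)%E.
  rewrite (ge0_integral_reflect (2 * m) _ _ (measurable_itv _) (mpdf setT) pdf0).
  rewrite (_ : _ @^-1` _ = [set` `[m, +oo[]); last first.
    by apply/seteqP; split => x /=; rewrite !in_itv/= ?andbT; lra.
  apply: eq_integral => x _ /=.
  have pdfE y : normal_pdf m s y =
      normal_peak s * expR (- (y - m) ^+ 2 / (s ^+ 2 *+ 2)).
    by rewrite normal_pdfE.
  rewrite (pdfE x) (pdfE (2 * m - x)).
  have -> : 2 * m - x - m = - (x - m) by lra.
  by rewrite sqrrN.
have II : (I + I = 1)%E.
  rewrite -[RHS](integral_normal_pdf m s) -set_itvNyy.
  rewrite (@itv_bndbnd_setU _ _ _ (BLeft m))// ge0_integral_setU//.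
  - rewrite -[X in (X + _)%E]symI; congr (_ + _)%E.
    by rewrite integral_itv_bndo_bndc; last exact: mpdf.
  - by apply/disj_setPS => y [/=]; rewrite !in_itv/= andbT; lra.
have : (0 <= I)%E by exact: integral_ge0.
case: I II {symI} => //= r; rewrite -EFinD => -[]; move=> rr _; congr _%:E; lra.
Qed.

(** The standard deviation [1 / (t sqrt 2)] turns the normal density into
    [exp (- (t (x - m))^2)] up to a constant. *)
Lemma normal_pdf_gauss (t m x : R) : 0 < t ->
  normal_pdf m (t * Num.sqrt 2)^-1 x =
  t / Num.sqrt pi * expR (- (t * (x - m)) ^+ 2).
Proof.
move=> t0; have s20 : 0 < Num.sqrt 2 :> R by rewrite sqrtr_gt0.
have s0 : (t * Num.sqrt 2)^-1 != 0 by rewrite invr_eq0 mulf_neq0// gt_eqF.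
have s2 : (t * Num.sqrt 2)^-1 ^+ 2 = (2 * t ^+ 2)^-1 :> R.
  by rewrite exprVn exprMn sqr_sqrtr// mulrC.
rewrite normal_pdfE// /normal_peak /normal_fun s2; congr (_ * expR _).
  rewrite (_ : _ *+ 2 = pi / t ^+ 2); last by field; rewrite gt_eqF.
  rewrite sqrtrM ?pi_ge0// sqrtrV ?sqr_ge0// sqrtr_sqr gtr0_norm// invfM invrK.
  by rewrite mulrC.
by field; rewrite gt_eqF.
Qed.

(** For [t > 0] the smoothed step is one minus the mass that the centered normal
    law with density [t / sqrt pi * exp (- (t y)^2)] gives to [y > K].  There
    [y^2 >= K^2 + (y - K)^2], so this tail is at most [exp (- (K t)^2)] times
    the half mass of the same law recentered at [K]. *)
Lemma smooth_step_tail (K t : R) : 0 <= K -> 0 < t ->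
  1 - 2^-1 * expR (- (K * t) ^+ 2) <= smooth_step K t <= 1.
Proof.
move=> K0 t0; pose s : R := (t * Num.sqrt 2)^-1.
have s0 : s != 0 by rewrite invr_eq0 mulf_neq0// gt_eqF// sqrtr_gt0.
have sp0 : 0 < Num.sqrt pi :> R by rewrite sqrtr_gt0 pi_gt0.
have mpdf m (D : set (measurableTypeR R)) :
    measurable_fun D (fun x : measurableTypeR R => (normal_pdf m s x)%:E).
  by apply: measurable_funTS; apply/measurable_EFinP; exact: measurable_normal_pdf.
have pdf0 m (x : R) : (0 <= (normal_pdf m s x)%:E)%E.
  by rewrite lee_fin normal_pdf_ge0.
have ipdf : mu.-integrable `[0, K] (EFin \o normal_pdf 0 s).
  by apply: integrableS (integrable_normal_pdf 0 s).
have -> : smooth_step K t = 2^-1 + \int[mu]_(y in `[0, K]) normal_pdf 0 s y.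
  rewrite /smooth_step; congr (_ + _).
  rewrite (_ : Rintegral _ _ _ =
      \int[mu]_(y in `[0, K]) (Num.sqrt pi * normal_pdf 0 s y)).
    by rewrite RintegralZl// mulKf// gt_eqF.
  apply: eq_Rintegral => y _; rewrite normal_pdf_gauss// subr0.
  by rewrite mulrA mulrCA divff ?mulr1// gt_eqF.
set a := Rintegral _ _ _.
have tail : (\int[mu]_(y in `]K, +oo[) (normal_pdf 0 s y)%:E <=
    (2^-1 * expR (- (K * t) ^+ 2))%:E)%E.
  rewrite mulrC EFinM -(integral_normal_pdf_half K _ s0).
  rewrite -ge0_integralZl ?lee_fin ?expR_ge0//.
  rewrite integral_itv_obnd_cbnd; last exact: mpdf.
  apply: ge0_le_integral => //.
    exact: measurable_funeM (mpdf _ _).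
  move=> y /=; rewrite in_itv/= andbT => Ky.
  rewrite -EFinM lee_fin /s (normal_pdf_gauss t 0 y t0).
  rewrite (normal_pdf_gauss t K y t0) mulrCA.
  rewrite ler_pM2l ?divr_gt0// -expRD ler_expR subr0.
  (* the cross term of [y ^+ 2 = (K + (y - K)) ^+ 2] *)
  have : 0 <= t ^+ 2 * (K * (y - K)).
    by rewrite mulr_ge0 ?sqr_ge0// mulr_ge0// subr_ge0.
  nra.
have aE : (\int[mu]_(y in `[0%R, K]) (normal_pdf 0 s y)%:E = a%:E)%E.
  by rewrite /a /Rintegral fineK//; exact: integrable_fin_num.
have := integral_normal_pdf_half 0 _ s0.
rewrite (@itv_bndbnd_setU _ _ _ (BRight K))//= ge0_integral_setU//=; last first.
  by apply/disj_setPS => y [/=]; rewrite !in_itv/= andbT; lra.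
rewrite aE.
have tail0 : (0 <= \int[mu]_(y in `]K, +oo[) (normal_pdf 0 s y)%:E)%E.
  exact: integral_ge0.
move: tail tail0; case: (integral _ _ _) => //= b.
rewrite -EFinD !lee_fin => bub b0 [] ab.
by apply/andP; split; lra.
Qed.

Lemma smooth_stepE (K t : R) : smooth_step K t =
  2^-1 + (Num.sqrt pi)^-1 * (t * \int[mu]_(y in `[0, K]) expR (- (t * y) ^+ 2)).
Proof.
rewrite /smooth_step RintegralZl//.
apply: continuous_compact_integrable; first exact: segment_compact.
apply: continuous_subspaceT => y.
apply: (@continuous_comp _ _ _ (fun y => t * y) (@gauss_fun R)).
  by apply: cvgMl_tmp; exact: cvg_id.
exact: continuous_gauss_fun.
Qed.

Lemma smooth_stepN (K t : R) : smooth_step K (- t) = 1 - smooth_step K t.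
Proof.
rewrite !smooth_stepE.
have -> : \int[mu]_(y in `[0, K]) expR (- (- t * y) ^+ 2) =
    \int[mu]_(y in `[0, K]) expR (- (t * y) ^+ 2).
  by apply: eq_Rintegral => y _; rewrite mulNr sqrrN.
by rewrite mulNr; field; rewrite gt_eqF// sqrtr_gt0 pi_gt0.
Qed.

Lemma smooth_step0 (K : R) : smooth_step K 0 = 2^-1.
Proof. by have := smooth_stepN K 0; rewrite oppr0; lra. Qed.

(** The symmetry [smooth_stepN] about one half reduces negative [t] to
    [smooth_step_tail]; at [t = 0] both sides equal one half. *)
Lemma smooth_step_error (K t : R) : 0 <= K ->
  `|((0 <= t)%R : nat)%:R - smooth_step K t| <= 2^-1 * expR (- (K * t) ^+ 2).
Proof.
move=> K0; have [t0|t0|<-] := ltgtP 0 t.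
- have := smooth_step_tail K t K0 t0.
  move=> /andP[? ?] /=; rewrite ?mulr1n ?mulr0n ger0_norm; lra.
- have nt0 : 0 < - t by rewrite oppr_gt0.
  have := smooth_step_tail K (- t) K0 nt0.
  rewrite smooth_stepN mulrN sqrrN.
  move=> /andP[? ?] /=; rewrite ?mulr1n ?mulr0n ler0_norm; lra.
- rewrite smooth_step0 mulr0 expr0n/= oppr0 expR0.
  by rewrite /= ?mulr1n ger0_norm; lra.
Qed.

Lemma smooth_step_itv (K t : R) : 0 <= K -> 0 <= smooth_step K t <= 1.
Proof.
move=> K0; have eN x : 2^-1 * expR (- (K * x) ^+ 2) <= 2^-1 :> R.
  by rewrite ler_piMr// -expR0 ler_expR oppr_le0 sqr_ge0.
have [t0|t0|<-] := ltgtP 0 t.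
- have := smooth_step_tail K t K0 t0.
  by move=> /andP[? ?]; have ? := eN t; apply/andP; split; lra.
- have nt0 : 0 < - t by rewrite oppr_gt0.
  have := smooth_step_tail K (- t) K0 nt0.
  rewrite smooth_stepN => /andP[? ?]; have ? := eN (- t).
  by apply/andP; split; lra.
- by rewrite smooth_step0; apply/andP; split; lra.
Qed.

(** Written as in [smooth_stepE], the integral has a nonnegative integrand and
    depends measurably on [t] by Tonelli's theorem. *)
Lemma measurable_smooth_step (K : R) : measurable_fun setT (@smooth_step R K).
Proof.
rewrite (_ : @smooth_step R K = fun t => 2^-1 + (Num.sqrt pi)^-1 *
    (t * \int[mu]_(y in `[0, K]) expR (- (t * y) ^+ 2))); last first.
  by apply/funext => t; exact: smooth_stepE.
apply: measurable_funD => //; apply: measurable_funM => //.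
apply: measurable_funM => //; rewrite /Rintegral.
apply: (measurableT_comp (f := @fine R)) => //=.
pose h := (fun p : measurableTypeR R * measurableTypeR R =>
  (expR (- (p.1 * p.2) ^+ 2))%:E) \_ ([set: R] `*` `[0%R, K]).
have mh : measurable_fun setT h.
  apply: (measurable_restrictT _ _).1 => /=; first exact: measurableX.
  apply: measurable_funTS; apply/measurable_EFinP.
  apply: measurableT_comp => //; apply: measurableT_comp => //.
  by apply: measurable_funX; apply: measurable_funM.
have h0 p : (0 <= h p)%E.
  by apply: erestrict_ge0 => //= x _; rewrite lee_fin expR_ge0.
have := measurable_fun_fubini_tonelli_F (m2 := mu) h mh h0.
apply: eq_measurable_fun => t _; rewrite /fubini_F [RHS]integral_mkcond.
by apply: eq_integral => x _; rewrite /h /patch in_setX in_setT.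
Qed.

End gauss_tail.

(** * A Gaussian of the squared distance, along a line *)

Section gauss_line.
Context {R : realType}.
Local Notation mu := (@lebesgue_measure R).

(** On [u >= d] the square function expands distances by a factor at least
    [2 d].  If [A] is a square [s^2] with [s >= d], compare [u] with [s];
    otherwise every [u^2] lies above [A], and [d] is the closest point. *)
Lemma ex_sqr_gap (d A : R) : 0 < d ->
  exists s, forall u, d <= u -> (2 * d * (u - s)) ^+ 2 <= (A - u ^+ 2) ^+ 2.
Proof.
move=> d0; have [Ad|dA] := leP A (d ^+ 2).
  exists d => u du.
  have : 2 * d * (u - d) <= u ^+ 2 - A by nra.
  have : 0 <= 2 * d * (u - d) by rewrite !mulr_ge0// ?subr_ge0// ltW.
  nra.
have A0 : 0 <= A by nra.
(* Here [A > d^2], so [sqrt A >= d] and [u + sqrt A >= 2 d]. *)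
exists (Num.sqrt A) => u du; rewrite -[in leRHS](sqr_sqrtr A0).
have : d <= Num.sqrt A.
  by rewrite -(ler_sqr (ltW d0)) ?nnegrE ?sqrtr_ge0 ?sqr_sqrtr// ltW.
set s := Num.sqrt A => ds.
rewrite subr_sqr [leRHS]exprMn [leLHS]exprMn mulrC -opprB sqrrN.
rewrite ler_wpM2l ?sqr_ge0// ler_sqr ?nnegrE; lra.
Qed.

(** Along a line whose coordinate stays at distance [d] from [c], the squared
    distance moves at speed at least [2 d], so the integrand is at most half of
    a Gaussian of parameter [2 d K], whose integral over the whole line is
    [sqrt pi / (2 d K)]. *)
Lemma gauss_sqdist_le (K d c A : R) : 0 < K -> 0 < d ->
  c <= - d \/ 1 + d <= c ->
  (\int[mu]_(x in `[0%R, 1%R])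
    (2^-1 * expR (- (K * (A - (x - c) ^+ 2)) ^+ 2))%:E <=
    (Num.sqrt pi / (4 * d * K))%:E)%E.
Proof.
move=> K0 d0 cd; have [s sP] := ex_sqr_gap d A d0.
have [x0 x0P] : exists x0, forall x, 0 <= x <= 1 ->
    (2 * d * (x - x0)) ^+ 2 <= (A - (x - c) ^+ 2) ^+ 2.
  case: cd => cd; [exists (c + s)|exists (c - s)] => x x01.
    by rewrite opprD addrA; apply: sP; lra.
  rewrite (_ : (x - c) ^+ 2 = (c - x) ^+ 2); last by ring.
  rewrite (_ : (2 * d * (x - (c - s))) ^+ 2 =
      (2 * d * ((c - x) - s)) ^+ 2); last by ring.
  by apply: sP; lra.
(* the parameter of the dominating Gaussian, centered at [x0] *)
pose t := 2 * d * K.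
have t0 : 0 < t by rewrite !mulr_gt0.
have sp0 : 0 < Num.sqrt pi :> R by rewrite sqrtr_gt0 pi_gt0.
pose w := (t * Num.sqrt 2)^-1 : R.
have mf : measurable_fun setT (fun x : R =>
    (2^-1 * expR (- (K * (A - (x - c) ^+ 2)) ^+ 2))%:E).
  apply/measurable_EFinP; apply: measurable_funM => //.
  apply: measurableT_comp => //; apply: measurableT_comp => //.
  apply: measurable_funX; apply: measurable_funM => //.
  apply: measurable_funB => //; apply: measurable_funX.
  exact: measurable_funB.
have mpdf : measurable_fun setT (fun x => (Num.sqrt pi / (4 * d * K))%:E *
    (normal_pdf x0 w x)%:E)%E.
  apply: emeasurable_funM => //; apply/measurable_EFinP.
  exact: measurable_normal_pdf.
have C0 : 0 <= Num.sqrt pi / (4 * d * K).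
  by rewrite divr_ge0 ?sqrtr_ge0// !mulr_ge0// ltW.
rewrite -[leRHS]mule1 -(integral_normal_pdf x0 w).
rewrite -ge0_integralZl//; last 2 first.
  by apply/measurable_EFinP; exact: measurable_normal_pdf.
  by move=> x _; rewrite lee_fin normal_pdf_ge0.
apply: (@le_trans _ _ (\int[mu]_(x in `[0%R, 1%R]) ((Num.sqrt pi / (4 * d * K))%:E *
    (normal_pdf x0 w x)%:E))%E); last first.
  apply: ge0_subset_integral => //.
  by move=> x _; rewrite mule_ge0// lee_fin normal_pdf_ge0.
apply: ge0_le_integral => //.
- exact: measurable_funTS.
- exact: measurable_funTS.
move=> x /=; rewrite in_itv/= => x01.
rewrite -EFinM lee_fin normal_pdf_gauss// mulrA.
rewrite (_ : _ / _ * _ = 2^-1); last first.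
  by rewrite /t; field; rewrite !gt_eqF.
rewrite ler_pM2l// ler_expR lerN2.
have := x0P _ x01; rewrite /t.
have : 0 <= K ^+ 2 by exact: sqr_ge0.
rewrite [X in _ -> _ -> X <= _](_ : _ =
  K ^+ 2 * (2 * d * (x - x0)) ^+ 2); last by ring.
by rewrite [X in _ -> _ -> _ <= X]exprMn => ? ?; rewrite ler_wpM2l.
Qed.

End gauss_line.

(** * A coordinate far from the center *)

Section far_center.
Context {R : realType}.
Implicit Types n : nat.

Lemma enorm_sqr n (x : 'rV[R]_n) : enorm x ^+ 2 = \sum_i x 0 i ^+ 2.
Proof. by rewrite sqr_sqrtr// sumr_ge0// => i _; exact: sqr_ge0. Qed.

(** The point of the cube nearest to [C] is its coordinatewise projection.  Its
    squared distance to [C], at least 1, is a sum of [n] squares, so that the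
    largest of them is at least [1 / n]. *)
Lemma ex_far_coordinate n (C : 'rV[R]_n) :
  1 <= inf [set enorm (x - C) | x in unit_cube n] ->
  (1 <= n)%N ->
  exists j d, [/\ 0 < d, 1 <= n%:R * d ^+ 2 & C 0 j <= - d \/ 1 + d <= C 0 j].
Proof.
case: n C => // n C hC _.
(* the coordinatewise projection of [C] onto the cube *)
pose p : 'rV[R]_n.+1 := \row_i Num.max 0 (Num.min 1 (C 0 i)).
have pU : unit_cube n.+1 p.
  by move=> i; rewrite mxE le_max lexx ge_max ler01 ge_min lexx.
have p1 : 1 <= enorm (p - C).
  apply: le_trans hC _; apply: ge_inf; last by exists p.
  by exists 0 => _ [x _ <-]; rewrite sqrtr_ge0.
have {p1} : 1 <= \sum_i (p - C) 0 i ^+ 2.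
  by rewrite -enorm_sqr -[leLHS](expr1n _ 2) ler_sqr ?nnegrE// sqrtr_ge0.
have [j _ jmax] := @Order.TotalTheory.arg_maxP _ _ _ ord0 xpredT
   (fun i => (p - C) 0 i ^+ 2) isT.
move=> p1; exists j, `|(p - C) 0 j|.
have e1 : 1 <= n.+1%:R * `|(p - C) 0 j| ^+ 2.
  apply: le_trans p1 _; rewrite real_normK ?num_real//.
  apply: (@le_trans _ _ (\sum_(i < n.+1) (p - C) 0 j ^+ 2)).
    by apply: ler_sum => i _; exact: jmax.
  by rewrite sumr_const card_ord mulr_natl.
have d0 : 0 < `|(p - C) 0 j|.
  rewrite normr_gt0; apply/eqP => e0.
  by move: e1; rewrite e0 normr0 expr0n/= mulr0 ler10.
split => //; move: d0; rewrite !mxE.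
case: (ltP 1 (C 0 j)) => c1.
  rewrite (max_r ler01) ler0_norm; last lra.
  by move=> _; right; lra.
case: (ltP (C 0 j) 0) => c0.
  rewrite ger0_norm; last lra.
  by move=> _; left; lra.
by rewrite subrr normr0 ltxx.
Qed.

(** Since [d >= 1 / sqrt n], the left side is at most [sqrt (pi n) / (4 K)], and
    the right side is at least [sqrt (n / 2) / K]; the
    comparison comes down to [pi <= 8]. *)
Lemma gauss_constant_le n (d K : R) : (1 <= n)%N -> 0 < d -> 0 < K ->
  1 <= n%:R * d ^+ 2 ->
  Num.sqrt pi / (4 * d * K) <= n%:R / (Num.sqrt (2 * n%:R - 1) * K).
Proof.
move=> n1 d0 K0 nd.
have n1R : 1 <= n%:R :> R by rewrite ler1n.
have q0 : 0 < 2 * n%:R - 1 :> R by lra.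
have s0 : 0 < Num.sqrt (2 * n%:R - 1) :> R by rewrite sqrtr_gt0.
rewrite ler_pdivrMr ?mulr_gt0// mulrAC ler_pdivlMr ?mulr_gt0//.
rewrite mulrA [leRHS](_ : _ = (4 * d * n%:R) * K); last by ring.
rewrite ler_pM2r// -sqrtrM ?pi_ge0//.
rewrite -(ler_sqr); last 2 first.
- by rewrite nnegrE sqrtr_ge0.
- by rewrite nnegrE !mulr_ge0// ltW.
rewrite sqr_sqrtr ?mulr_ge0 ?pi_ge0// ?(ltW q0)//.
have pi4 : pi <= 4 :> R by have := @pihalf_lt2 R; lra.
have : pi * (2 * n%:R - 1) <= 4 * (2 * n%:R - 1) :> R by rewrite ler_pM2r.
have : 16 * n%:R * (n%:R * d ^+ 2) >= 16 * n%:R :> R by rewrite ler_peMr// mulr_ge0.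
lra.
Qed.

End far_center.

(** * The smoothed volume of the lens *)

Section lens.
Context {R : realType}.
Implicit Types n : nat.

Lemma unit_cube_row_of_tuple n (t : n.-tuple R) :
  unit_cube n (row_of_tuple t) <-> tuple_cube n t.
Proof.
by split => H i; have := H i; rewrite mxE in_itv.
Qed.

Lemma rho_row_of_tuple n (C : 'rV[R]_n) r (t : n.-tuple R) :
  rho C r (row_of_tuple t) = r ^+ 2 - \sum_i (tnth t i - C 0 i) ^+ 2.
Proof.
by rewrite /rho enorm_sqr; congr (_ - _); apply: eq_bigr => i _; rewrite !mxE.
Qed.

Lemma measurable_rho n (C : 'rV[R]_n) r :
  measurable_fun setT
    (fun t : n.-tuple (measurableTypeR R) => rho C r (row_of_tuple t)).
Proof.
under eq_fun do rewrite rho_row_of_tuple.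
apply: measurable_funB => //; apply: measurable_sum => i.
apply: measurable_funX; apply: measurable_funB => //.
exact: measurable_tnth.
Qed.

(** Up to the constant [r^2], [rho] is minus a sum of functions of the single
    coordinates, and the coordinate [j] far from [C] controls the integral. *)
Lemma cube_gauss_rho_le n (C : 'rV[R]_n) (r K : R) :
  (1 <= n)%N -> 1 <= inf [set enorm (x - C) | x in unit_cube n] -> 0 < K ->
  (\int[lebesgue_tuple n]_(t in tuple_cube n)
     (2^-1 * expR (- (K * rho C r (row_of_tuple t)) ^+ 2))%:E
   <= (n%:R / (Num.sqrt (2 * n%:R - 1) * K))%:E)%E.
Proof.
move=> n1 hC K0; have [j [d [d0 nd cd]]] := ex_far_coordinate n C hC n1.
pose phi (u : R) := 2^-1 * expR (- (K * u) ^+ 2).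
under eq_integral do rewrite rho_row_of_tuple.
apply: (@le_cube_integral_fiber _ n phi (fun i x => (x - C 0 i) ^+ 2) _ j).
- apply: measurable_funM => //; apply: measurableT_comp => //.
  apply: measurableT_comp => //; apply: measurable_funX.
  exact: measurable_funM.
- by move=> i; apply: measurable_funX; exact: measurable_funB.
- by move=> x; rewrite mulr_ge0// expR_ge0.
- move=> A; apply: (le_trans (gauss_sqdist_le K d (C 0 j) A K0 d0 cd)).
  by rewrite lee_fin; exact: gauss_constant_le.
Qed.

Lemma vol_unit_cube n : vol (unit_cube n) = 1%E :> \bar R.
Proof.
rewrite -(lebesgue_tuple_cube n) /vol; congr (lebesgue_tuple n _).
by apply/seteqP; split => t /= /unit_cube_row_of_tuple.
Qed.

(** The hull contains the cube. *)
Lemma vol_conv_cube_ge1 n (C : 'rV[R]_n) : (1 <= vol (conv_cube C))%E.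
Proof.
rewrite -(vol_unit_cube n); apply: le_lebesgue_tuple => t /= tU.
exists 1, (row_of_tuple t), (row_of_tuple t); split => //.
- by rewrite ler01 lexx.
- by left.
- by left.
- by rewrite scale1r subrr scale0r addr0.
Qed.

Lemma vol_lens n (C0 C1 : 'rV[R]_n) (r0 r1 : R) : 0 < r0 -> 0 < r1 ->
  (vol (unit_cube n `&` closed_eball C0 r0 `&` closed_eball C1 r1) =
   \int[lebesgue_tuple n]_(t in tuple_cube n)
     (((0 <= rho C0 r0 (row_of_tuple t))%R : nat)%:R *
      ((0 <= rho C1 r1 (row_of_tuple t))%R : nat)%:R)%:E)%E.
Proof.
move=> r00 r10.
pose E := [set t : n.-tuple (measurableTypeR R) |
  0 <= rho C0 r0 (row_of_tuple t) /\ 0 <= rho C1 r1 (row_of_tuple t)].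
have mE : measurable E.
  rewrite (_ : E = [set t | 0 <= rho C0 r0 (row_of_tuple t)] `&`
                   [set t | 0 <= rho C1 r1 (row_of_tuple t)])//.
  apply: measurableI; rewrite -[X in measurable X]setTI.
    by apply: measurable_fun_le => //; exact: measurable_rho.
  by apply: measurable_fun_le => //; exact: measurable_rho.
have ball C r x : 0 < r -> closed_eball C r x <-> 0 <= @rho R n C r x.
  move=> r_gt0; rewrite /closed_eball /rho /= subr_ge0 ler_sqr//.
    by rewrite nnegrE sqrtr_ge0.
  by rewrite nnegrE ltW.
transitivity (lebesgue_tuple n (E `&` tuple_cube n)).
  rewrite /vol; congr (lebesgue_tuple n _).
  apply/seteqP; split => t /=.
    move=> [[/unit_cube_row_of_tuple ? /ball ?] /ball ?].
    by split => //; split; auto.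
  by move=> [[? ?] /unit_cube_row_of_tuple ?]; split; [split|] => //; exact/ball.
rewrite -integral_indic//; last exact: measurable_tuple_cube.
apply: eq_integral => t _; rewrite indicE /E.
case: (boolP (0 <= rho C0 _ _)) => h0; case: (boolP (0 <= rho C1 _ _)) => h1 /=.
- by rewrite mem_set ?mulr1.
- by rewrite memNset ?mulr0//= => -[]; rewrite ?(negbTE h1).
- by rewrite memNset ?mul0r//= => -[]; rewrite ?(negbTE h0).
- by rewrite memNset ?mul0r//= => -[]; rewrite ?(negbTE h0).
Qed.

Lemma ler_dist_mul (a b c d : R) : 0 <= a <= 1 -> 0 <= d <= 1 ->
  `|a * b - c * d| <= `|a - c| + `|b - d|.
Proof.
move=> /andP[a0 a1] /andP[d0 d1].
rewrite (_ : a * b - c * d = (a - c) * d + a * (b - d)); last by ring.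
apply: (le_trans (ler_normD _ _)); rewrite !normrM (ger0_norm d0) (ger0_norm a0).
by apply: lerD; [rewrite ler_piMr|rewrite ler_piMl].
Qed.

(** The indicators [f] and the smoothed product [g] differ pointwise by at most
    [e], the sum of the two Gaussian errors.  Integrating [f <= g + e] and
    [g <= f + e] keeps all integrands nonnegative. *)
Lemma lens_smoothing_error n (C0 C1 : 'rV[R]_n) (r0 r1 K : R) :
  (1 <= n)%N -> 0 < r0 -> 0 < r1 ->
  1 <= inf [set enorm (x - C0) | x in unit_cube n] ->
  1 <= inf [set enorm (x - C1) | x in unit_cube n] ->
  0 < K ->
  (`|vol (unit_cube n `&` closed_eball C0 r0 `&` closed_eball C1 r1)
      - (smooth_vol C0 r0 C1 r1 K)%:E|
   <= (n%:R / (Num.sqrt (2 * n%:R - 1) * K) +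
       n%:R / (Num.sqrt (2 * n%:R - 1) * K))%:E)%E.
Proof.
move=> n1 r00 r10 hC0 hC1 K0; have K0' := ltW K0.
rewrite vol_lens//.
set B := n%:R / _.
have mK C r : measurable_fun setT (fun t : n.-tuple (measurableTypeR R) =>
    smooth_step K (rho C r (row_of_tuple t))).
  exact: (measurableT_comp (@measurable_smooth_step R K) (measurable_rho n C r)).
have mI C r : measurable_fun setT (fun t : n.-tuple (measurableTypeR R) =>
    ((0 <= rho C r (row_of_tuple t))%R : nat)%:R : R).
  rewrite (_ : (fun _ => _) =
      \1_(`[0, +oo[ : set R) \o (fun t => rho C r (row_of_tuple t))).
    have mH : measurable_fun setT (\1_(`[0, +oo[ : set R) : R -> R).
      exact: measurable_indic.
    exact: (measurableT_comp mH (measurable_rho n C r)).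
  apply/funext => t /=; rewrite indicE; congr (nat_of_bool _)%:R.
  by apply/idP/idP; rewrite inE /= in_itv/= andbT.
have me C r : measurable_fun setT (fun t : n.-tuple (measurableTypeR R) =>
    2^-1 * expR (- (K * rho C r (row_of_tuple t)) ^+ 2)).
  apply: measurable_funM => //; apply: measurableT_comp => //.
  apply: measurableT_comp => //; apply: measurable_funX.
  by apply: measurable_funM => //; exact: measurable_rho.
pose f (t : n.-tuple (measurableTypeR R)) : R :=
  ((0 <= rho C0 r0 (row_of_tuple t))%R : nat)%:R *
  ((0 <= rho C1 r1 (row_of_tuple t))%R : nat)%:R.
pose g (t : n.-tuple (measurableTypeR R)) : R :=
  smooth_step K (rho C0 r0 (row_of_tuple t)) *
  smooth_step K (rho C1 r1 (row_of_tuple t)).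
pose e (t : n.-tuple (measurableTypeR R)) : R :=
  2^-1 * expR (- (K * rho C0 r0 (row_of_tuple t)) ^+ 2) +
  2^-1 * expR (- (K * rho C1 r1 (row_of_tuple t)) ^+ 2).
have mf : measurable_fun setT f by exact: measurable_funM.
have mg : measurable_fun setT g by exact: measurable_funM.
have mee : measurable_fun setT e by exact: measurable_funD.
have fge t : `|f t - g t| <= e t.
  apply: (le_trans (ler_dist_mul _ _ _ _ _ _)).
  - by rewrite ler0n lern1 leq_b1.
  - exact: smooth_step_itv.
  - by apply: lerD; exact: smooth_step_error.
have e0 t : 0 <= e t by exact: le_trans (fge t).
have f0 t : 0 <= f t by rewrite mulr_ge0.
have g01 t : 0 <= g t <= 1.
  have /andP[a0 a1] := smooth_step_itv K (rho C0 r0 (row_of_tuple t)) K0'.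
  have /andP[b0 b1] := smooth_step_itv K (rho C1 r1 (row_of_tuple t)) K0'.
  by apply/andP; split; [exact: mulr_ge0 a0 b0|exact: mulr_ile1 a0 b0 a1 b1].
have g0 t : 0 <= g t by case/andP: (g01 t).
have mE (u : n.-tuple (measurableTypeR R) -> R) :
    measurable_fun setT u ->
    measurable_fun (@tuple_cube R n) (fun t => (u t)%:E).
  by move=> mu; apply: measurable_funTS; exact/measurable_EFinP.
have mC := measurable_tuple_cube (R := R) n.
have eB : (\int[lebesgue_tuple n]_(t in tuple_cube n) (e t)%:E <= (B + B)%:E)%E.
  under eq_integral do rewrite EFinD.
  rewrite ge0_integralD//; [|exact: mE|exact: mE].
  by rewrite EFinD; apply: leeD; exact: cube_gauss_rho_le.
have le_add (u v : n.-tuple (measurableTypeR R) -> R) :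
    measurable_fun setT u -> measurable_fun setT v ->
    (forall t, 0 <= u t) -> (forall t, 0 <= v t) ->
    (forall t, u t <= v t + e t) ->
    (\int[lebesgue_tuple n]_(t in tuple_cube n) (u t)%:E <=
     \int[lebesgue_tuple n]_(t in tuple_cube n) (v t)%:E + (B + B)%:E)%E.
  move=> mu mv u0 v0 uv.
  apply: (@le_trans _ _ (\int[lebesgue_tuple n]_(t in tuple_cube n)
      ((v t)%:E + (e t)%:E))%E).
    apply: ge0_le_integral => //.
    - by move=> t _; rewrite lee_fin.
    - exact: mE.
    - by apply: emeasurable_funD; exact: mE.
    - by move=> t _; rewrite -EFinD lee_fin.
  rewrite ge0_integralD//; [|by move=> t _; rewrite lee_fin|exact: mE|
    by move=> t _; rewrite lee_fin|exact: mE].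
  exact: leeD2l.
have fgt t : f t <= g t + e t by have := fge t; rewrite ler_norml; lra.
have gft t : g t <= f t + e t by have := fge t; rewrite ler_norml; lra.
have := le_add f g mf mg f0 g0 fgt; have := le_add g f mg mf g0 f0 gft.
have -> : (\int[lebesgue_tuple n]_(t in tuple_cube n) (g t)%:E =
    (smooth_vol C0 r0 C1 r1 K)%:E)%E.
  by apply/esym; exact: iterated_int01E.
rewrite /f; have : (0 <= \int[lebesgue_tuple n]_(t in tuple_cube n) (f t)%:E)%E.
  by apply: integral_ge0 => t _; rewrite lee_fin.
rewrite /f; case: (integral _ _ _) => // v _.
rewrite -!EFinD !lee_fin => h1 h2; rewrite ler_norml; lra.
Qed.

End lens.

(** * The error bound *)

Theorem lemma1 (R : realType) (n : nat) (C0 C1 : 'rV[R]_n) (r0 r1 : R)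
    (hn : (1 <= n)%N) (hr0 : 0 < r0) (hr1 : 0 < r1)
    (hC0 : 1 <= inf [set enorm (x - C0) | x in unit_cube n])
    (hC1 : 1 <= inf [set enorm (x - C1) | x in unit_cube n])
    (K : R) (hK : 0 < K) :
  (`|vol (unit_cube n `&` closed_eball C0 r0 `&` closed_eball C1 r1)
      - (smooth_vol C0 r0 C1 r1 K)%:E|
   <= (n%:R / (Num.sqrt (2 * n%:R - 1) * K))%:E
      * (vol (conv_cube C0) + vol (conv_cube C1)))%E.
Proof.
apply: (le_trans (lens_smoothing_error _ _ _ _ _ _ hn hr0 hr1 hC0 hC1 hK)).
set B := n%:R / _.
have B0 : 0 <= B by rewrite divr_ge0// mulr_ge0 ?sqrtr_ge0// ltW.
rewrite -[in leLHS](mulr1 B) -mulrDr EFinM lee_wpmul2l ?lee_fin//.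
by rewrite EFinD; apply: leeD; exact: vol_conv_cube_ge1.
Qed.
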